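(* Let $R$ be an integral domain, $T$ a commutative ring with identity, $f:R\to T$ a ring homomorphism, $J$ an ideal of $T$, $M$ a finitely generated faithful multiplication $R$-module which is also a valuation module, $N$ a $T$-module (regarded as an $R$-module via $f$), $\varphi:M\to N$ an $R$-module homomorphism, and $F$ a submodule of $M$. Then: (1) If $F$ is a $p$-primary submodule of $M$ for some prime ideal $p$ of $R$ with $p^2M\subseteq F$, then $F\bowtie^{\varphi}JN$ is a 2-absorbing submodule of the $(R\bowtie^{f}J)$-module $M\bowtie^{\varphi}JN$. (2) If $F=P$ or $F=P^2$ for some prime submodule $P$ of $M$ with $P=M\text{-}\mathrm{rad}\,F$, then $F\bowtie^{\varphi}JN$ is a 2-absorbing submodule of $M\bowtie^{\varphi}JN$.
   Context: All rings are commutative with identity and all modules are unital. For a submodule $F$ of an $R$-module $M$, $(F:_R M)=\{r\in R: rM\subseteq F\}$; $M$ is faithful if $(0:_R M)=0$. $M$ is a multiplication module if every submodule has the form $IM$ for some ideal $I$ of $R$. A module $M$ over an integral domain $R$ is a valuation module if for all nonzero $m,n\in M$, either $Rm\subseteq Rn$ or $Rn\subseteq Rm$. A proper submodule $F$ of $M$ is 2-absorbing if whenever $a,b\in R$, $m\in M$ and $abm\in F$, then $ab\in(F:_R M)$ or $am\in F$ or $bm\in F$. A proper submodule $F$ is prime if $rm\in F$ implies $m\in F$ or $r\in(F:_R M)$; it is primary if $rm\in F$ implies $m\in F$ or $r^k\in(F:_R M)$ for some $k\ge1$, and $p$-primary if moreover $\sqrt{(F:_R M)}=p$. $M\text{-}\mathrm{rad}\,F$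 is the intersection of all prime submodules of $M$ containing $F$. In a multiplication module the product of submodules $IM$ and $I'M$ is $II'M$; thus $P^2=(P:_R M)^2M$. $R\bowtie^{f}J=\{(r,f(r)+j): r\in R,\ j\in J\}$ is a subring of $R\times T$. $M\bowtie^{\varphi}JN=\{(m,\varphi(m)+n): m\in M,\ n\in JN\}$ is an $(R\bowtie^{f}J)$-module under $(r,f(r)+j)\cdot(m,\varphi(m)+n)=(rm,\varphi(rm)+f(r)n+j\varphi(m)+jn)$, and $F\bowtie^{\varphi}JN=\{(m,\varphi(m)+n): m\in F,\ n\in JN\}$ is a submodule of it. *)

(* Defs.v *)
From HB Require Import structures.
From mathcomp Require Import all_boot all_order all_algebra.
From mathcomp Require Import boolp.

Set Implicit Arguments.
Unset Strict Implicit.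
Unset Printing Implicit Defensive.

Import GRing.Theory.
Local Open Scope ring_scope.

(* Submodules are boolean predicates, with [ `[< P >] ] ([asbool]) turning a
   proposition into a boolean; ideals of [A] are submodules of [A^o].  Equality
   of submodules is extensional equality [=i]. *)

Section Modules.
Variables (A : comPzRingType) (V : lmodType A).
Implicit Types (I : {pred A}) (F P : {pred V}).

(* The finite sums of products [a *: v]: this is the submodule I F. *)
Definition smul I F : {pred V} := fun x =>
  `[< exists n (a : 'I_n -> A) (v : 'I_n -> V),
        [/\ forall i, a i \in I, forall i, v i \in F
          & x = \sum_(i < n) a i *: v i] >].

Definition colon F : {pred A} := fun r => `[< forall m : V, r *: m \in F >].

Definition cyclic_submodule (m : V) : {pred V} :=
  fun x => `[< exists r : A, x = r *: m >].

Definition proper_submodule F : Prop := submod_closed F /\ ~ (F =i predT).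

Definition prime_submodule F : Prop :=
  proper_submodule F /\
  forall (r : A) (m : V), r *: m \in F -> m \in F \/ r \in colon F.

Definition primary_submodule F : Prop :=
  proper_submodule F /\
  forall (r : A) (m : V), r *: m \in F ->
    m \in F \/ exists2 k : nat, (0 < k)%N & r ^+ k \in colon F.

Definition two_absorbing F : Prop :=
  proper_submodule F /\
  forall (a b : A) (m : V), (a * b) *: m \in F ->
    [\/ a * b \in colon F, a *: m \in F | b *: m \in F].

Definition mrad F : {pred V} := fun x =>
  `[< forall P, prime_submodule P -> {subset F <= P} -> x \in P >].

Lemma smul_submod_closed (I : submodClosed A^o) F : submod_closed (smul I F).
Proof.
split; first by apply/asboolP; exists 0, (fun=> 0), (fun=> 0);
  split=> [[]|[]|] //; rewrite big_ord0.
move=> r x y /asboolP[n [a [v [aI vF ->]]]] /asboolP[k [b [w [bI wF ->]]]].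
apply/asboolP; exists (n + k)%N.
exists (fun i => match split i with inl j => r * a j | inr j => b j end).
exists (fun i => match split i with inl j => v j | inr j => w j end); split.
- move=> i; case: (split i) => j //; exact: (@rpredZ A A^o I r _ (aI j)).
- by move=> i; case: (split i).
rewrite big_split_ord /= scaler_sumr; congr (_ + _); apply: eq_bigr => i _.
- by rewrite (unsplitK (inl _ i)) scalerA.
- by rewrite (unsplitK (inr _ i)).
Qed.

End Modules.

HB.instance Definition _ (A : comPzRingType) (V : lmodType A)
    (I : submodClosed A^o) (F : {pred V}) :=
  GRing.isSubmodClosed.Build A V (smul I F) (smul_submod_closed I F).

Definition ideal_mul (A : comPzRingType) (I I' : {pred A}) : {pred A} :=
  @smul A A^o I I'.

Definition ideal_radical (A : comPzRingType) (I : {pred A}) : {pred A} :=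
  fun r => `[< exists2 k : nat, (0 < k)%N & r ^+ k \in I >].

Definition p_primary_submodule (A : comPzRingType) (V : lmodType A)
    (p : {pred A}) (F : {pred V}) : Prop :=
  primary_submodule F /\ ideal_radical (colon F) =i p.

(* The square of a submodule of a multiplication module. *)
Definition submodule_sqr (A : comPzRingType) (V : lmodType A) (P : {pred V}) :
    {pred V} :=
  smul (ideal_mul (colon P) (colon P)) predT.

Definition faithful_module (A : comPzRingType) (V : lmodType A) : Prop :=
  forall r : A, r \in colon (pred1 (0 : V)) -> r = 0.

Definition fingen_module (A : comPzRingType) (V : lmodType A) : Prop :=
  exists n (g : 'I_n -> V), forall x : V,
    exists a : 'I_n -> A, x = \sum_(i < n) a i *: g i.

Definition multiplication_module (A : comPzRingType) (V : lmodType A) : Prop :=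
  forall F : submodClosed V, exists I : submodClosed A^o, F =i smul I predT.

Definition valuation_module (A : idomainType) (V : lmodType A) : Prop :=
  forall m n : V, m != 0 -> n != 0 ->
    {subset cyclic_submodule m <= cyclic_submodule n} \/
    {subset cyclic_submodule n <= cyclic_submodule m}.

Section AmalgamatedRing.
Variables (R T : comPzRingType) (f : {rmorphism R -> T}) (J : submodClosed T^o).

Definition amalg_ring_pred : {pred R * T} := fun x =>
  `[< exists r j, j \in J /\ x = (r, f r + j) >].

Lemma amalg_ring_predP (x : R * T) :
  reflect (x.2 - f x.1 \in J) (x \in amalg_ring_pred).
Proof.
apply: (iffP (asboolP _)) => [[r [j [jJ ->]]]|xJ] /=.
  by rewrite addrC addKr.
by exists x.1, (x.2 - f x.1); split=> //; rewrite addrC subrK; case: x {xJ}.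
Qed.

Lemma amalg_ring_subring_closed : subring_closed amalg_ring_pred.
Proof.
split.
- by apply/amalg_ring_predP; rewrite /= rmorph1 subrr (rpred0 J).
- move=> x y /amalg_ring_predP xJ /amalg_ring_predP yJ; apply/amalg_ring_predP.
  have -> : x.2 - y.2 - f (x.1 - y.1) = (x.2 - f x.1) - (y.2 - f y.1).
    by rewrite rmorphB !opprD !opprK addrACA.
  exact: (GRing.submod_closedB (@submodClosedP T T^o J)).2.
- move=> x y /amalg_ring_predP xJ /amalg_ring_predP yJ; apply/amalg_ring_predP.
  rewrite /= rmorphM.
  have -> : x.2 * y.2 - f x.1 * f y.1
          = y.2 * (x.2 - f x.1) + f x.1 * (y.2 - f y.1).
    by rewrite !mulrBr mulrC [y.2 * f _]mulrC addrA subrK.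
  exact: (@rpredD T^o J _ _ (@rpredZ T T^o J _ _ xJ) (@rpredZ T T^o J _ _ yJ)).
Qed.

Record amalg_ring := AmalgRing {
  amalg_ring_val :> R * T;
  _ : amalg_ring_val \in amalg_ring_pred }.

HB.instance Definition _ := [isSub for amalg_ring_val].
HB.instance Definition _ := [Choice of amalg_ring by <:].
HB.instance Definition _ :=
  GRing.SubChoice_isSubComPzRing.Build _ _ amalg_ring
    amalg_ring_subring_closed.

End AmalgamatedRing.

Section AmalgamatedModule.
Variables (R T : comPzRingType) (f : {rmorphism R -> T}) (J : submodClosed T^o).
Variables (M : lmodType R) (N : lmodType T).
Variable phi : {linear M -> N | f \; *:%R}.

Definition amalg_pred (F : {pred M}) : {pred M * N} := fun x =>
  `[< exists m n, [/\ m \in F, n \in smul J (predT : {pred N})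
                    & x = (m, phi m + n)] >].

Lemma amalg_predP (x : M * N) :
  reflect (x.2 - phi x.1 \in smul J (predT : {pred N}))
          (x \in amalg_pred predT).
Proof.
apply: (iffP (asboolP _)) => [[m [n [_ nJ ->]]]|xJ] /=.
  by rewrite addrC addKr.
exists x.1, (x.2 - phi x.1); split=> //.
by rewrite addrC subrK; case: x {xJ}.
Qed.

Lemma amalg_mod_zmod_closed : zmod_closed (amalg_pred predT).
Proof.
split; first by apply/amalg_predP; rewrite /= raddf0 subrr rpred0.
move=> x y /amalg_predP xJ /amalg_predP yJ; apply/amalg_predP => /=.
have -> : x.2 - y.2 - phi (x.1 - y.1) = (x.2 - phi x.1) - (y.2 - phi y.1).
  by rewrite raddfB !opprD !opprK addrACA.
exact: rpredB.
Qed.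

Record amalg_mod := AmalgMod {
  amalg_mod_val :> M * N;
  _ : amalg_mod_val \in amalg_pred predT }.

HB.instance Definition _ := [isSub for amalg_mod_val].
HB.instance Definition _ := [Choice of amalg_mod by <:].
HB.instance Definition _ :=
  GRing.SubChoice_isSubZmodule.Build _ _ amalg_mod amalg_mod_zmod_closed.

Lemma amalg_scale_subproof (a : amalg_ring f J) (x : amalg_mod) :
  ((val a).1 *: (val x).1, (val a).2 *: (val x).2) \in amalg_pred predT.
Proof.
case: a x => [[r t] /= /asboolP[r' [j [jJ [-> ->]]]]].
case=> [[m n'] /= /asboolP[m' [n [_ nJN [-> ->]]]]].
apply/amalg_predP => /=.
have -> : (f r' + j) *: (phi m' + n) - phi (r' *: m')
        = (f r' + j) *: n + j *: phi m'.
  rewrite linearZ /= scalerDr [(_ + j) *: phi _]scalerDl addrAC.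
  by rewrite [_ + j *: phi _]addrC addrK addrC.
apply: rpredD; first exact: rpredZ.
apply/asboolP; exists 1%N, (fun=> j), (fun=> phi m'); split=> //.
by rewrite big_ord1.
Qed.

(* Componentwise action; [amalg_scaleE] expands it in the r, j, m, n form. *)
Definition amalg_scale (a : amalg_ring f J) (x : amalg_mod) : amalg_mod :=
  AmalgMod (amalg_scale_subproof a x).

Lemma amalg_scaleA a b x :
  amalg_scale a (amalg_scale b x) = amalg_scale (a * b) x.
Proof. by apply: val_inj; rewrite /= !scalerA. Qed.

Lemma amalg_scale1 : left_id 1 amalg_scale.
Proof. by move=> x; apply: val_inj; rewrite /= !scale1r; case: (val x). Qed.

Lemma amalg_scaleDr : right_distributive amalg_scale +%R.
Proof. by move=> a x y; apply: val_inj; rewrite /= !scalerDr. Qed.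

Lemma amalg_scaleDl x : {morph amalg_scale^~ x : a b / a + b}.
Proof. by move=> a b; apply: val_inj; rewrite /= !scalerDl. Qed.

HB.instance Definition _ :=
  GRing.Zmodule_isLmodule.Build (amalg_ring f J) amalg_mod
    amalg_scaleA amalg_scale1 amalg_scaleDr amalg_scaleDl.

Lemma amalg_scaleE (a : amalg_ring f J) (x : amalg_mod) r j m n :
  val a = (r, f r + j) -> val x = (m, phi m + n) ->
  val (a *: x) =
    (r *: m, phi (r *: m) + f r *: n + j *: phi m + j *: n).
Proof.
move=> ea ex; rewrite /= ea ex /= linearZ /=; congr pair.
by rewrite scalerDl !scalerDr !addrA.
Qed.

Definition amalg_sub (F : {pred M}) : {pred amalg_mod} :=
  fun x => val x \in amalg_pred F.

End AmalgamatedModule.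

Arguments faithful_module {A} V.
Arguments fingen_module {A} V.
Arguments multiplication_module {A} V.
Arguments valuation_module {A} V.
Arguments amalg_sub {R T f} J {M N} phi F.

(* Main.v *)
Require Import Defs.
From HB Require Import structures.
From mathcomp Require Import all_boot all_order all_algebra.
From mathcomp Require Import boolp.

Set Implicit Arguments.
Unset Strict Implicit.
Unset Printing Implicit Defensive.
Local Open Scope ring_scope.

(** The first coordinate of an element of the amalgamated module decides its
    membership in [amalg_sub J phi F], and likewise the first coordinate of a
    scalar decides its membership in the colon ideal; hence [amalg_sub J phi F]
    is 2-absorbing as soon as [F] is ([amalg_sub_two_absorbing]).

    It remains to see that [F] is 2-absorbing.  Let [(a * b) *: m] lie in [F].
    If [F] is [p]-primary and neither [a *: m] nor [b *: m] is in [F], then [a]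
    and [b] are both in [p], so that [a * b] multiplies [M] into [p^2 M], which
    is contained in [F].  Prime submodules are clearly 2-absorbing.

    Let finally [F = P^2 = p^2 M] with [p] the colon ideal of the prime
    submodule [P].  A finitely generated valuation module is cyclic
    ([valuation_module_cyclic]), and being faithful it is isomorphic to [R], so
    it is torsion-free and [R] is a valuation domain.  If [a] is not in [p], then
    every element of [p] is [a] times an element of [p] ([colon_prime_divl]);
    thus [p^2 M = a p^2 M], and cancelling [a] in [(a * b) *: m] gives that
    [b *: m] is in [p^2 M].  The same holds with [a] and [b] exchanged, and if
    both are in [p] then [a * b] is in [p^2]. *)

Import GRing.Theory.

(** * Two-absorbing submodules and products of ideals with submodules *)

Section Products.
Variables (A : comPzRingType) (V : lmodType A).
Implicit Types (I : {pred A}) (F : {pred V}).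

Lemma mem_smul I F a v : a \in I -> v \in F -> a *: v \in smul I F.
Proof.
move=> aI vF; apply/asboolP; exists 1%N, (fun=> a), (fun=> v).
by split=> //; rewrite big_ord1.
Qed.

Lemma smul_sub_colon I F (G : submodClosed V) :
  {subset I <= colon G} -> {subset smul I F <= G}.
Proof.
move=> IG x /asboolP[n [a [v [aI _ ->]]]]; apply: rpred_sum => i _.
by have /asboolP := IG _ (aI i); apply.
Qed.

(** An inclusion of [I] in [a I'] gives one of [I F] in [a (I' F)]. *)
Lemma smul_divl I I' F (a : A) :
    (forall y, y \in I -> exists2 z, z \in I' & y = a * z) ->
  forall x, x \in smul I F -> exists2 w, w \in smul I' F & x = a *: w.
Proof.
move=> Idiv x /asboolP[n [b [v [bI vF ->]]]].
have /fin_all_exists2[c cI bE] i := Idiv _ (bI i).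
exists (\sum_(i < n) c i *: v i); first by apply/asboolP; exists n, c, v.
by rewrite scaler_sumr; apply: eq_bigr => i _; rewrite bE scalerA.
Qed.

Lemma smul_closed I F : @submod_closed A A^o I -> submod_closed (smul I F).
Proof.
move=> Iclosed; pose IC := GRing.isSubmodClosed.Build A A^o _ Iclosed.
pose I' : submodClosed A^o := HB.pack (I : {pred A^o}) IC.
exact: (smul_submod_closed I').
Qed.

Lemma colon_submod_closed (P : submodClosed V) :
  @submod_closed A A^o (colon P).
Proof.
split=> [|r a b /asboolP aP /asboolP bP]; apply/asboolP => m.
  by rewrite scale0r rpred0.
rewrite -[r *: a]/(r * a) scalerDl -scalerA.
by apply: rpredD; first apply: rpredZ.
Qed.

End Products.

Section Submodules.
Variables (A : comPzRingType) (V : lmodType A).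
Implicit Types (F G : {pred V}).

Lemma eq_two_absorbing F G : F =i G -> two_absorbing G -> two_absorbing F.
Proof.
move=> FG [[[G0 GD] Gp] Gabs]; split.
  split; last by move=> FT; apply: Gp => x; rewrite -FG FT.
  by split=> [|r x y]; rewrite !FG //; apply: GD.
move=> a b m; rewrite !FG => /Gabs[/asboolP abG|->|->].
- by constructor 1; apply/asboolP => x; rewrite FG.
- by constructor 2.
- by constructor 3.
Qed.

Lemma prime_two_absorbing F : prime_submodule F -> two_absorbing F.
Proof.
move=> [Fp Fprime]; split=> // a b m; rewrite -scalerA => /Fprime[bmF|aF].
  by constructor 3.
by constructor 2; move/asboolP: aF; apply.
Qed.

Lemma p_primary_two_absorbing (p : {pred A}) F :
    p_primary_submodule p F ->
    {subset smul (ideal_mul p p) (predT : {pred V}) <= F} ->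
  two_absorbing F.
Proof.
move=> [[Fp Fprim] Frad] ppF; split=> // a b m abmF.
have radP r x : r *: x \in F -> x \in F \/ r \in p.
  by move=> /Fprim[|rF]; [left | right; rewrite -Frad; apply/asboolP].
have [bmF|ap] : b *: m \in F \/ a \in p by apply: radP; rewrite scalerA.
  by constructor 3.
have [amF|bp] : a *: m \in F \/ b \in p.
- by apply: radP; rewrite scalerA mulrC.
- by constructor 2.
constructor 1; apply/asboolP => x.
by apply/ppF/mem_smul => //; apply: (@mem_smul A A^o).
Qed.

Lemma submodule_sqr_submod_closed (P : submodClosed V) :
  submod_closed (submodule_sqr P).
Proof.
exact/smul_closed/smul_closed/colon_submod_closed.
Qed.

Lemma submodule_sqr_sub (P : submodClosed V) :
  {subset submodule_sqr P <= P}.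
Proof.
apply: smul_sub_colon => r /asboolP[n [a [b [_ bP ->]]]].
apply/asboolP => m; rewrite scaler_suml; apply: rpred_sum => i _.
have /asboolP biP := bP i.
by rewrite -[a i *: b i]/(a i * b i) -scalerA rpredZ.
Qed.

End Submodules.

(** * Transfer to the amalgamated module *)

Section Amalgamation.
Variables (R T : comPzRingType) (f : {rmorphism R -> T}) (J : submodClosed T^o).
Variables (M : lmodType R) (N : lmodType T).
Variable phi : {linear M -> N | f \; *:%R}.
Implicit Types (F : {pred M}) (x : amalg_mod J phi) (a : amalg_ring f J).

Lemma mem_amalg_sub F x : (x \in amalg_sub J phi F) = ((val x).1 \in F).
Proof.
apply/asboolP/idP => [[m [n [mF _ ->]]] //|xF].
have /asboolP[m [n [_ nJ ex]]] := valP x.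
by exists m, n; split=> //; rewrite ex in xF.
Qed.

(** The projection of the amalgamated module onto [M] is surjective, because
    the graph of [phi] is contained in that module. *)
Lemma amalg_mod_lift (m : M) : exists x, (val x).1 = m.
Proof.
have mP : (m, phi m) \in amalg_pred J phi predT.
  by apply/amalg_predP; rewrite /= subrr rpred0.
by exists (AmalgMod mP).
Qed.

Lemma mem_colon_amalg_sub F a :
  (val a).1 \in colon F -> a \in colon (amalg_sub J phi F).
Proof.
move=> /asboolP aF; apply/asboolP => x.
by rewrite mem_amalg_sub; apply: aF.
Qed.

Lemma amalg_sub_two_absorbing F :
  two_absorbing F -> two_absorbing (amalg_sub J phi F).
Proof.
move=> [[[F0 FD] Fp] Fabs]; split; [split; first split|].
- by rewrite mem_amalg_sub.
- by move=> a x y; rewrite !mem_amalg_sub; apply: FD.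
- move=> FT; apply: Fp => m; have [x <-] := amalg_mod_lift m.
  by rewrite -mem_amalg_sub FT.
move=> a b x; rewrite !mem_amalg_sub => /Fabs[abF|aF|bF].
- by constructor 1; apply: mem_colon_amalg_sub.
- by constructor 2.
- by constructor 3.
Qed.

End Amalgamation.

(** * Finitely generated faithful valuation modules *)

Section ValuationModules.
Variables (R : idomainType) (M : lmodType R).

Lemma valuation_module_total (x y : M) : valuation_module M ->
  (exists c, x = c *: y) \/ (exists c, y = c *: x).
Proof.
move=> M_val; have [->|x0] := eqVneq x 0.
  by left; exists 0; rewrite scale0r.
have [->|y0] := eqVneq y 0; first by right; exists 0; rewrite scale0r.
have cyc_refl (z : M) : z \in cyclic_submodule z.
  by apply/asboolP; exists 1; rewrite scale1r.
have [/(_ _ (cyc_refl x))|/(_ _ (cyc_refl y))] := M_val _ _ x0 y0.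
  by move/asboolP; left.
by move/asboolP; right.
Qed.

Lemma valuation_module_cyclic : fingen_module M -> valuation_module M ->
  exists g : M, forall x, exists c, x = c *: g.
Proof.
move=> [n [g gM]] M_val.
suff [h hP] : exists h, forall i, exists c, g i = c *: h.
  exists h => x; have [a ->] := gM x; have [c cP] := fin_all_exists hP.
  exists (\sum_(i < n) a i * c i); rewrite scaler_suml.
  by apply: eq_bigr => i _; rewrite cP scalerA.
elim: n g {gM} => [|n IHn] g; first by exists 0; case.
have [h hP] := IHn (fun i => g (lift ord0 i)).
have [[c gE]|[c hE]] := valuation_module_total (g ord0) h M_val.
  exists h => i; have [j ->|->] := unliftP ord0 i; first exact: hP.
  by exists c.
exists (g ord0) => i; have [j ->|->] := unliftP ord0 i.
  by have [d ->] := hP j; exists (d * c); rewrite hE scalerA.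
by exists 1; rewrite scale1r.
Qed.

Section CyclicFaithful.
Variable g : M.
Hypotheses (M_val : valuation_module M) (M_faithful : faithful_module M).
Hypothesis gM : forall x, exists c, x = c *: g.

Lemma scale_generator_inj : injective (fun r : R => r *: g).
Proof.
move=> r s /eqP; rewrite -subr_eq0 -scalerBl => /eqP rsg.
apply/eqP; rewrite -subr_eq0; apply/eqP/M_faithful/asboolP => x.
have [c ->] := gM x.
by rewrite inE scalerA mulrC -scalerA rsg scaler0.
Qed.

Lemma cyclic_faithful_scaler_inj (a : R) : a != 0 ->
  injective (fun x : M => a *: x).
Proof.
move=> a0 x y; have [c ->] := gM x; have [d ->] := gM y.
by rewrite !scalerA => /scale_generator_inj /(mulfI a0) ->.
Qed.

(** In terms of the valuation domain [R]: a prime ideal is divisible by each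
    element outside it. *)
Lemma colon_prime_divl (P : submodClosed M) (a : R) :
    prime_submodule P -> a \notin colon P ->
  forall q, q \in colon P -> exists2 s, s \in colon P & q = a * s.
Proof.
move=> [_ Pprime] aP q qP; move: (qP) => /asboolP qMP.
have [[c]|[c]] := valuation_module_total (a *: g) (q *: g) M_val.
  rewrite scalerA => /scale_generator_inj aE; case/negP: aP.
  by apply/asboolP => x; rewrite aE -scalerA rpredZ.
rewrite scalerA => /scale_generator_inj; rewrite mulrC => qE.
exists c => //; apply/asboolP => x.
have := qMP x; rewrite qE -scalerA => /Pprime[//|].
by move=> aP'; rewrite aP' in aP.
Qed.

Lemma submodule_sqr_cancel (P : submodClosed M) (a : R) (x : M) :
    prime_submodule P -> a \notin colon P ->
  a *: x \in submodule_sqr P -> x \in submodule_sqr P.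
Proof.
move=> Pprime aP; have pdiv := colon_prime_divl Pprime aP.
have a0 : a != 0.
  by apply: contraNneq aP => ->; apply/asboolP => y; rewrite scale0r rpred0.
have ppdiv := @smul_divl R R^o _ _ (colon P) a pdiv.
by move=> /(smul_divl ppdiv)[w wP] /(cyclic_faithful_scaler_inj a0) ->.
Qed.

Lemma submodule_sqr_two_absorbing (P : submodClosed M) :
  prime_submodule P -> two_absorbing (submodule_sqr P).
Proof.
move=> Pprime; have [[_ Pp] _] := Pprime.
split.
  split; first exact: submodule_sqr_submod_closed.
  by move=> sqrT; apply: Pp => x; rewrite (submodule_sqr_sub (P := P)) ?sqrT.
move=> a b m abm; have [aP|aP] := boolP (a \in colon P); last first.
  by constructor 3; apply: (submodule_sqr_cancel Pprime aP); rewrite scalerA.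
have [bP|bP] := boolP (b \in colon P); last first.
  constructor 2; apply: (submodule_sqr_cancel Pprime bP).
  by rewrite scalerA mulrC.
constructor 1; apply/asboolP => x.
by apply: mem_smul => //; apply: (@mem_smul R R^o).
Qed.

End CyclicFaithful.
End ValuationModules.

Theorem corollary3p5 (R : idomainType) (T : comPzRingType)
    (f : {rmorphism R -> T}) (J : submodClosed T^o)
    (M : lmodType R) (N : lmodType T) (phi : {linear M -> N | f \; *:%R})
    (F : submodClosed M)
    (M_fingen : fingen_module M) (M_faithful : faithful_module M)
    (M_mult : multiplication_module M) (M_val : valuation_module M) :
  (forall p : prime_idealr R,
     p_primary_submodule p F ->
     {subset smul (ideal_mul p p) (predT : {pred M}) <= F} ->
     two_absorbing (amalg_sub J phi F))
  /\
  (forall P : submodClosed M,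
     prime_submodule P -> P =i mrad F ->
     F =i P \/ F =i submodule_sqr P ->
     two_absorbing (amalg_sub J phi F)).
Proof.
split=> [p Fprim ppF|P Pprime _ FP]; apply: amalg_sub_two_absorbing.
  exact: p_primary_two_absorbing Fprim ppF.
have [g gM] := valuation_module_cyclic M_fingen M_val.
case: FP => FP; apply: (eq_two_absorbing FP).
  exact: prime_two_absorbing.
exact: submodule_sqr_two_absorbing M_val M_faithful gM _ Pprime.
Qed.
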